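(* Let $0<\alpha<\beta\le 1$ and $f\in C^{0,\beta}(\mathbb{R})$. Then $f^{\alpha}_{+}(x)=(D_{\rm right})^{\alpha}f(x)$ and $f^{\alpha}_{-}(x)=(D_{\rm left})^{\alpha}f(x)$ for every $x\in\mathbb{R}$ (in particular the limits defining $f^\alpha_\pm(x)$ exist). Moreover, there exists a positive constant $C_{\alpha,\beta}$, depending only on $\alpha$ and $\beta$, such that for all $x\in\mathbb{R}$ and all $h>0$, $$\left|(D_{\rm right})^{\alpha}f(x)-\frac{\Delta_{h,+}^{\alpha}f(x)}{h^\alpha}\right|\leq C_{\alpha,\beta}\,[f]_{C^{0,\beta}(\mathbb{R})}\,h^{\beta-\alpha}$$ and $$\left|(D_{\rm left})^{\alpha}f(x)-\frac{\Delta_{h,-}^{\alpha}f(x)}{h^\alpha}\right|\leq C_{\alpha,\beta}\,[f]_{C^{0,\beta}(\mathbb{R})}\,h^{\beta-\alpha}.$$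
   Context: The Marchaud derivatives are, for $0<\alpha<1$, $$(D_{\rm right})^{\alpha}f(x)=\frac{1}{\Gamma(-\alpha)}\int_0^{\infty}\frac{f(x+t)-f(x)}{t^{1+\alpha}}dt,\qquad (D_{\rm left})^{\alpha}f(x)=\frac{1}{\Gamma(-\alpha)}\int_0^{\infty}\frac{f(x-t)-f(x)}{t^{1+\alpha}}dt.$$ The fractional differences of order $\alpha$ are $\Delta_{h,\pm}^\alpha f(x)=\sum_{k=0}^\infty(-1)^k\binom{\alpha}{k}f(x\pm kh)$, $x\in\mathbb{R}$, $h>0$, and the Grünwald–Letnikov derivatives are $f^{\alpha}_\pm(x)=\lim_{h\to0^+}\frac{\Delta_{h,\pm}^\alpha f(x)}{h^\alpha}$. The space $C^{0,\beta}(\mathbb{R})$ consists of continuous functions $f:\mathbb{R}\to\mathbb{R}$ with finite norm $\|f\|_{L^\infty(\mathbb{R})}+[f]_{C^{0,\beta}(\mathbb{R})}$, where $[f]_{C^{0,\beta}(\mathbb{R})}=\sup_{x\neq y}\frac{|f(x)-f(y)|}{|x-y|^\beta}$. *)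

(* Defs.v *)
From HB Require Import structures.
From mathcomp Require Import all_boot all_order all_algebra.
From mathcomp Require Import all_classical all_reals all_analysis.

Set Implicit Arguments.
Unset Strict Implicit.
Unset Printing Implicit Defensive.

Import Order.TTheory GRing.Theory Num.Theory.
Import numFieldNormedType.Exports.

Local Open Scope classical_set_scope.
Local Open Scope ring_scope.

Definition Gamma_integral {R : realType} (s : R) : R :=
  \int[lebesgue_measure]_(t in `]0, +oo[) (t `^ (s - 1) * expR (- t)).

(* For s <= 0 the integral is extended by Gamma s = Gamma (s + 1) / s, applied
   n times, where n is such that s + n > 0. The value at the poles
   0, -1, -2, ... is 0 since division by zero yields zero. *)
Definition Gamma {R : realType} (s : R) : R :=
  if 0 < s then Gamma_integral s
  else let n := (Num.truncn (- s)).+1 in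
       Gamma_integral (s + n%:R) / \prod_(i < n) (s + i%:R).

Definition gbinom {R : realType} (a : R) (k : nat) : R :=
  (\prod_(i < k) (a - i%:R)) / k`!%:R.

(* The integrands are named so that integrability, which the real-valued
   integral does not record, can be stated separately. *)
Definition marchaud_right_integrand {R : realType} (a : R) (f : R -> R) (x t : R)
    : R := (f (x + t) - f x) / t `^ (1 + a).

Definition marchaud_left_integrand {R : realType} (a : R) (f : R -> R) (x t : R)
    : R := (f (x - t) - f x) / t `^ (1 + a).

Definition marchaud_right {R : realType} (a : R) (f : R -> R) (x : R) : R :=
  (Gamma (- a))^-1 *
  \int[lebesgue_measure]_(t in `]0, +oo[) marchaud_right_integrand a f x t.

Definition marchaud_left {R : realType} (a : R) (f : R -> R) (x : R) : R :=
  (Gamma (- a))^-1 *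
  \int[lebesgue_measure]_(t in `]0, +oo[) marchaud_left_integrand a f x t.

Definition fdiff_plus_term {R : realType} (a h : R) (f : R -> R) (x : R)
    : R^nat := fun k => (-1) ^+ k * gbinom a k * f (x + k%:R * h).

Definition fdiff_minus_term {R : realType} (a h : R) (f : R -> R) (x : R)
    : R^nat := fun k => (-1) ^+ k * gbinom a k * f (x - k%:R * h).

Definition fdiff_plus {R : realType} (a h : R) (f : R -> R) (x : R) : R :=
  limn (series (fdiff_plus_term a h f x)).

Definition fdiff_minus {R : realType} (a h : R) (f : R -> R) (x : R) : R :=
  limn (series (fdiff_minus_term a h f x)).

Definition GL_plus {R : realType} (a : R) (f : R -> R) (x : R) : R :=
  lim (fdiff_plus a h f x / h `^ a @[h --> 0^'+]).

Definition GL_minus {R : realType} (a : R) (f : R -> R) (x : R) : R :=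
  lim (fdiff_minus a h f x / h `^ a @[h --> 0^'+]).

Definition holder_seminorm {R : realType} (b : R) (f : R -> R) : \bar R :=
  ereal_sup [set (`|f p.1 - f p.2| / `|p.1 - p.2| `^ b)%:E
            | p in [set p : R * R | p.1 != p.2]].

Definition C0beta {R : realType} (b : R) (f : R -> R) : Prop :=
  continuous f /\
  ('N[lebesgue_measure]_+oo [EFin \o f] + holder_seminorm b f < +oo)%E.

(* Main.v *)
Require Import Defs.
From HB Require Import structures.
From mathcomp Require Import all_boot all_order all_algebra.
From mathcomp Require Import all_classical all_reals all_analysis.
From mathcomp Require Import measurable_realfun ess_sup_inf ring lra.
Set Implicit Arguments.
Unset Strict Implicit.
Unset Printing Implicit Defensive.
Import Order.TTheory GRing.Theory Num.Theory.
Import numFieldNormedType.Exports.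
Local Open Scope classical_set_scope.
Local Open Scope ring_scope.

(* Write w_k = (-1)^k binom(alpha, k) and c = 1/Gamma(-alpha). The functional
   equation of Gamma gives w_k = c g_k with g_k = Gamma(k - alpha)/k! for
   k >= 1, and Wendel's inequality Gamma(s + theta) <= s^theta Gamma(s) gives
   k^(-1-alpha) <= g_k <= k^(-alpha)/(k - alpha). Hence, after scaling by h, g_k
   differs from t^(-1-alpha) on [k, k+1] by O(k^(-2-alpha)), and by Hoelder
   continuity the part of the Marchaud integral over ]kh, (k+1)h] differs from
   the k-th term of the difference quotient by at most a constant times
   [f] h^(beta-alpha) g_k; this uses k^(beta-1) <= 1. These errors are summable
   because sum_{k >= 1} |w_k| <= 1, while the integral over ]0, h] is itself
   O([f] h^(beta-alpha)). Subtracting f(x) in each term of the difference is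
   free since sum_k w_k = 0. *)

(** * Integrals over exhaustions and of powers *)

Lemma ge0_integral_le_exhaustion (R : realType) (f : R -> R)
    (D : set R) (E : (set R)^nat) (K : \bar R) :
  (forall n, measurable (E n)) -> nondecreasing_seq E ->
  D = \bigcup_n E n -> measurable_fun D f ->
  (forall x, D x -> 0 <= f x) ->
  (forall n, (\int[lebesgue_measure]_(x in E n) (f x)%:E <= K)%E) ->
  (\int[lebesgue_measure]_(x in D) (f x)%:E <= K)%E.
Proof.
move=> mE ndE DE mf f0 fK; rewrite DE in mf f0 *.
have H : ((\int[lebesgue_measure]_(x in E n) (f x)%:E)%E @[n --> \oo] -->
  (\int[lebesgue_measure]_(x in \bigcup_n E n) (f x)%:E)%E).
  apply: ge0_nondecreasing_set_cvg_integral => //.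
  - move=> n; apply/measurable_EFinP; apply: measurable_funS mf => //.
      exact: bigcup_measurable.
    exact: bigcup_sup.
  - by move=> n x Ex; rewrite lee_fin f0//; exists n.
rewrite -(cvg_lim _ H)//; apply: lime_le; first by apply/cvg_ex; eexists; exact: H.
by near=> n; exact: fK.
Unshelve. all: by end_near. Qed.

(** Dominated convergence for the restrictions of [f] to [E n], with [|f|] as majorant: at each
    point of [D] they eventually equal [f]. *)
Lemma Rintegral_cvg_exhaustion (R : realType) (f : R -> R) (D : set R)
    (E : (set R)^nat) :
  measurable D -> (forall n, measurable (E n)) -> (forall n, E n `<=` D) ->
  (forall x, D x -> \forall n \near \oo, E n x) ->
  lebesgue_measure.-integrable D (EFin \o f) ->
  \int[lebesgue_measure]_(x in E n) f x @[n --> \oo] -->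
    \int[lebesgue_measure]_(x in D) f x.
Proof.
move=> mD mE ED Ecvg fi.
have mf : measurable_fun D (EFin \o f) by case/integrableP: fi.
have mfE n : measurable_fun D ((EFin \o f) \_ (E n)).
  apply/measurable_restrict => //.
  by apply: measurable_funS mf => //; exact: subIsetl.
have fcvg : {ae lebesgue_measure, forall x, D x ->
    (fun n => ((EFin \o f) \_ (E n)) x) @ \oo --> (EFin \o f) x}.
  apply: aeW => x Dx; apply: cvg_near_cst; near=> n.
  by rewrite patchE mem_set//; near: n; exact: Ecvg.
have fdom : {ae lebesgue_measure, forall x n, D x ->
    (`|((EFin \o f) \_ (E n)) x| <= `|(EFin \o f) x|)%E}.
  by apply: aeW => x n Dx; rewrite patchE; case: ifPn => // _; rewrite abse0.
have [_ _ H] := @dominated_convergence _ _ _ lebesgue_measure _ mD _ _ _ mfE mf fcvg (integrable_abse fi) fdom.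
have fin : (\int[lebesgue_measure]_(x in D) (f x)%:E)%E \is a fin_num.
  exact: integrable_fin_num.
apply: fine_cvg; rewrite fineK//.
apply: cvg_trans H; apply: near_eq_cvg; near=> n.
rewrite -[in RHS](setIidr (ED n)).
exact/esym/integral_mkcondr.
Unshelve. all: by end_near. Qed.

Lemma integral_ftc (R : realType) (f F : R -> R) (a b : R) : 0 < a -> a < b ->
  (forall x : R, 0 < x -> {for x, continuous f}) ->
  (forall x : R, 0 < x -> is_derive x 1 F (f x)) ->
  (\int[lebesgue_measure]_(x in `[a, b]) (f x)%:E = (F b - F a)%:E)%E.
Proof.
move=> a0 ab cf dF.
have cF (x : R) : 0 < x -> {for x, continuous F}.
  by move=> x0; apply: differentiable_continuous; apply/derivable1_diffP; apply: ex_derive; exact: dF.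
rewrite (continuous_FTC2 ab (F := F))//.
- apply: continuous_in_subspaceT => x; rewrite inE/= in_itv/= => /andP[ax _].
  by apply: cf; exact: lt_le_trans ax.
- split.
  + move=> x; rewrite in_itv/= => /andP[ax _]; apply: ex_derive; apply: dF; exact: lt_trans ax.
  + by apply: cvg_at_right_filter; exact: cF.
  + by apply: cvg_at_left_filter; apply: cF; exact: lt_trans ab.
- move=> x; rewrite in_itv/= => /andP[ax _].
  by have /@derive_val := dF _ (lt_trans a0 ax); rewrite derive1E.
Qed.

Lemma continuous_powR (R : realType) (p x : R) : 0 < x -> {for x, continuous (fun t => t `^ p)}.
Proof.
move=> x0; apply: differentiable_continuous; apply/derivable1_diffP.
by apply: derivable_powR; rewrite in_itv/= x0.
Qed.

Lemma integral_powR_itv (R : realType) (p a b : R) : p != 0 -> 0 < a -> a < b ->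
  (\int[lebesgue_measure]_(x in `[a, b]) (x `^ (p - 1))%:E =
    ((b `^ p - a `^ p) / p)%:E)%E.
Proof.
move=> p0 a0 ab.
have dF (x : R) : 0 < x -> is_derive x 1 (fun x => p^-1 * x `^ p) (x `^ (p - 1)).
  move=> x0; have := is_deriveZ p^-1 (is_derive1_powR p x0).
  by rewrite /GRing.scale/= mulrA mulVf// mul1r.
rewrite (integral_ftc a0 ab _ dF) => [|x x0]; last exact: continuous_powR.
by rewrite -mulrBr mulrC.
Qed.

Lemma integral_powR_near0 (R : realType) (p h : R) : 0 < p -> 0 < h ->
  (\int[lebesgue_measure]_(x in `]0%R, h]) (x `^ (p - 1))%:E <= (h `^ p / p)%:E)%E.
Proof.
move=> p0 h0.
(* The denominators start at 2 because [integral_powR_itv] asks for a nondegenerate interval. *)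
apply: (@ge0_integral_le_exhaustion _ _ _ (fun n => `[h / n.+2%:R, h]%classic)).
- by [].
- apply/nondecreasing_seqP => n;
  apply/subsetPset => x /=; rewrite !in_itv/= => /andP[nx ->].
  rewrite ?andbT (le_trans _ nx)// ler_pM2l// lef_pV2 ?posrE ?ltr0n// ler_nat.
  by [].
- apply/seteqP; split => x /=; rewrite ?in_itv/=.
    move=> /andP[x0 xh]; exists (Num.truncn (h / x)) => //=.
    rewrite in_itv/= xh andbT ler_pdivrMr ?ltr0n// -ler_pdivrMl//.
    rewrite mulrC (le_trans (ltW (truncnS_gt _)))//; last by rewrite ler_nat.
  move=> [n _]/=; rewrite in_itv/= => /andP[nx ->]; rewrite andbT.
  by apply: lt_le_trans nx; rewrite divr_gt0.
- exact: measurable_funTS.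
- by move=> x _; exact: powR_ge0.
- move=> n; rewrite integral_powR_itv ?gt_eqF//.
  + by rewrite lee_fin ler_pM2r ?invr_gt0// gerBl powR_ge0.
  + by rewrite divr_gt0.
  + by rewrite ltr_pdivrMr// ltr_pMr// ltr1n.
Qed.

Lemma integral_powR_neary (R : realType) (q : R) : 0 < q ->
  (\int[lebesgue_measure]_(x in `[1%R, +oo[) (x `^ (- q - 1))%:E <= (q^-1)%:E)%E.
Proof.
move=> q0.
apply: (@ge0_integral_le_exhaustion _ _ _ (fun n => `[1, n.+2%:R]%classic)).
- by [].
- apply/nondecreasing_seqP => n; apply/subsetPset => x /=.
  rewrite !in_itv/= => /andP[-> nx].
  by rewrite /= (le_trans nx)// ler_nat.
- apply/seteqP; split => x /=; rewrite ?in_itv/= ?andbT.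
    move=> x1.
    exists (Num.truncn x) => //=; rewrite in_itv/= x1/= ltW//.
    have /lt_le_trans := truncnS_gt x; apply; rewrite ler_nat//.
  by move=> [n _]/=; rewrite in_itv/= => /andP[].
- exact: measurable_funTS.
- by move=> x _; exact: powR_ge0.
- move=> n; rewrite integral_powR_itv ?oppr_eq0 ?gt_eqF// ?ltr1n//.
  rewrite lee_fin powR1 invrN mulrN -mulNr opprB -[leRHS]mul1r ler_pM2r ?invr_gt0//.
Qed.

Lemma integrable_powR_near0 (R : realType) (p h : R) : 0 < p -> 0 < h ->
  lebesgue_measure.-integrable `]0, h] (EFin \o (fun x : R => x `^ (p - 1))).
Proof.
move=> p0 h0; apply/integrableP; split.
  by apply/measurable_EFinP; exact: measurable_funTS.
under eq_integral => x _ do rewrite /= ger0_norm ?powR_ge0//.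
by rewrite (le_lt_trans (integral_powR_near0 p0 h0))// ltry.
Qed.

Lemma integrable_powR_neary (R : realType) (q : R) : 0 < q ->
  lebesgue_measure.-integrable `[1, +oo[ (EFin \o (fun x : R => x `^ (- q - 1))).
Proof.
move=> q0; apply/integrableP; split.
  by apply/measurable_EFinP; exact: measurable_funTS.
under eq_integral => x _ do rewrite /= ger0_norm ?powR_ge0//.
by rewrite (le_lt_trans (integral_powR_neary q0))// ltry.
Qed.

(** The half-line is split at 1. The Gamma and the Marchaud integrands both get their integrability
    from this criterion. *)
Lemma integrable_powR_dominated (R : realType) (f : R -> R) (p q A B : R) :
  0 < p -> 0 < q -> measurable_fun (`]0, +oo[ : set R) f ->
  (forall t, 0 < t -> t <= 1 -> `|f t| <= A * t `^ (p - 1)) ->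
  (forall t, 1 <= t -> `|f t| <= B * t `^ (- q - 1)) ->
  lebesgue_measure.-integrable `]0, +oo[ (EFin \o f).
Proof.
move=> p0 q0 mf fA fB.
have DE : `]0, +oo[%classic = `]0, 1]%classic `|` `]1, +oo[%classic :> set R.
  apply/seteqP; split => x /=; rewrite !in_itv/= !andbT.
    by move=> ->; have [x1|x1] := leP x 1; [left|right].
  by case=> [/andP[]//|]; exact: lt_trans.
have [m1 m2] : measurable_fun (`]0, 1] : set R) f /\ measurable_fun (`]1, +oo[ : set R) f.
  by apply/measurable_funU => //; rewrite -DE.
have i1 : lebesgue_measure.-integrable `]0, 1] (EFin \o f).
  apply: (le_integrable _ _ _ (integrableZl _ A (integrable_powR_near0 p0 ltr01))) => //.
  - exact/measurable_EFinP.
  - move=> t /=; rewrite in_itv/= => /andP[t0 t1].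
    by rewrite lee_fin (le_trans (fA _ t0 t1))// ler_norm.
have i2 : lebesgue_measure.-integrable `]1, +oo[ (EFin \o f).
  have iq : lebesgue_measure.-integrable `]1, +oo[ (EFin \o (fun x : R => x `^ (- q - 1))).
    apply: integrableS (integrable_powR_neary q0) => //.
    by apply: subset_itvr; rewrite bnd_simp.
  apply: (le_integrable _ _ _ (integrableZl _ B iq)) => //.
  - exact/measurable_EFinP.
  - move=> t /=; rewrite in_itv/= andbT => /ltW t1.
    by rewrite lee_fin (le_trans (fB _ t1))// ler_norm.
apply/integrableP; split; first exact/measurable_EFinP.
rewrite DE ge0_integral_setU//=; last 2 first.
- by rewrite -DE; apply/measurable_EFinP; exact: measurableT_comp.
- rewrite disj_set2E; apply/disj_setPS => t [] /=; rewrite !in_itv/= andbT.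
  by move=> /andP[_ /le_lt_trans H] /H; rewrite ltxx.
by case/integrableP : i1 => _ h1; case/integrableP : i2 => _ h2; exact: lte_add_pinfty.
Qed.

Lemma Rintegral_cst_approx (R : realType) (f : R -> R) (c e x y : R) : x <= y ->
  lebesgue_measure.-integrable `]x, y] (EFin \o f) ->
  (forall t, x < t -> t <= y -> `|f t - c| <= e) ->
  `|\int[lebesgue_measure]_(t in `]x, y]) f t - c * (y - x)| <= e * (y - x).
Proof.
move=> xy fi fc.
have mu_xy : fine (lebesgue_measure (`]x, y]%classic : set R)) = y - x.
  rewrite lebesgue_measure_itv/= lte_fin; case: ltP => //= yx.
  by apply/esym/eqP; rewrite subr_eq0 eq_le xy yx.
have ci (r : R) : lebesgue_measure.-integrable `]x, y] (EFin \o cst r).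
  apply: measurable_bounded_integrable => //.
    by rewrite /= lebesgue_measure_itv/=; case: ifP => _; rewrite ?ltry// -EFinD ltry.
  by exists `|r|; split => // M rM x0 _; exact: ltW.
have di : lebesgue_measure.-integrable `]x, y] (EFin \o (fun t => f t - c)).
  exact: (integrableB _ fi (ci c)).
rewrite -mu_xy -!Rintegral_cst// -RintegralB//; last exact: (ci c).
apply: (le_trans (le_normr_Rintegral _ di)) => //.
apply: (le_Rintegral _ (integrable_abse di) (ci e)) => //.
by move=> t /=; rewrite in_itv/= => /andP[xt ty]; exact: fc.
Qed.

(** * The Gamma integral *)

Lemma cvg_harmonic_at_right (R : realType) : (n.+1%:R^-1 : R) @[n --> \oo] --> 0^'+.
Proof.
have inv0 : (n.+1%:R^-1 : R) @[n --> \oo] --> 0.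
  exact: cvg_harmonic.
move=> A; rewrite /= /at_right /within/= => /inv0 A0.
have {}A0 : \forall n \near \oo, 0 < (n.+1%:R^-1 : R) -> A n.+1%:R^-1 := A0.
by apply: filterS A0 => n; apply; rewrite invr_gt0 ltr0n.
Qed.

Lemma Rintegral_ftc0y (R : realType) (f F : R -> R) (l0 l : R) :
  (forall x : R, 0 < x -> {for x, continuous f}) ->
  (forall x : R, 0 < x -> is_derive x 1 F (f x)) ->
  lebesgue_measure.-integrable `]0, +oo[ (EFin \o f) ->
  F x @[x --> 0^'+] --> l0 -> F x @[x --> +oo] --> l ->
  \int[lebesgue_measure]_(x in `]0, +oo[) f x = l - l0.
Proof.
move=> cf dF fi F0 Fy.
have H : \int[lebesgue_measure]_(x in `[(n.+1%:R)^-1, n.+1%:R]) f x @[n --> \oo] -->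
    \int[lebesgue_measure]_(x in `]0, +oo[) f x.
  apply: Rintegral_cvg_exhaustion => //.
  - move=> n x /=; rewrite !in_itv/= andbT => /andP[+ _]; apply: lt_le_trans.
    by rewrite invr_gt0 ltr0n.
  - move=> x /=; rewrite in_itv/= andbT => x0; near=> n.
    rewrite /= in_itv/=; apply/andP; split.
      rewrite -[leRHS]invrK lef_pV2 ?posrE ?ltr0n ?invr_gt0//.
      rewrite (@le_trans _ _ n%:R)//; last by rewrite ler_nat.
      near: n; exact: nbhs_infty_ger.
    rewrite (@le_trans _ _ n%:R)//; last by rewrite ler_nat.
    near: n; exact: nbhs_infty_ger.
have H2 : F n.+1%:R - F n.+1%:R^-1 @[n --> \oo] --> l - l0.
  apply: cvgB.
    apply: (@cvg_comp _ _ _ (fun n => n.+1%:R) F _ _ _ _ Fy).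
    by apply/cvgrnyP; exact: (cvg_addnl 1).
  by apply: (@cvg_comp _ _ _ (fun n => n.+1%:R^-1) F _ _ _ _ F0); exact: cvg_harmonic_at_right.
apply: (cvg_unique _ H) => //; apply: cvg_trans H2; apply: near_eq_cvg; near=> n.
rewrite /= /Rintegral (integral_ftc _ _ cf dF)// ?invr_gt0//.
have n1 : (1 < n.+1)%N by rewrite ltnS; near: n; exact: nbhs_infty_gt.
by rewrite (@lt_trans _ _ 1)// ?invf_lt1 ?ltr0n ?ltr1n.
Unshelve. all: by end_near. Qed.

(** For N = [truncn r] + 1 > r and t >= 1 one has t^r <= t^N, while e^t >= t^N / N!. *)
Lemma powR_expRN_bounded (R : realType) (r : R) :
  exists B : R, forall t, 1 <= t -> t `^ r * expR (- t) <= B.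
Proof.
exists ((Num.truncn r).+1`!%:R) => t t1.
rewrite expRN ler_pdivrMr ?expR_gt0// mulrC -ler_pdivrMr ?ltr0n ?fact_gt0//.
have t0 : 0 <= t by rewrite (le_trans _ t1).
rewrite (le_trans _ (expR_ge1Dxn (Num.truncn r) t0))//.
rewrite (@le_trans _ _ (t ^+ (Num.truncn r).+1 / (Num.truncn r).+1`!%:R))//; last first.
  by rewrite lerDr.
rewrite ler_pM2r ?invr_gt0 ?ltr0n ?fact_gt0// -powR_mulrn//.
by apply: ler_powR => //; apply/ltW/truncnS_gt.
Qed.

Lemma continuous_expRN (R : realType) : continuous (fun t : R => expR (- t)).
Proof.
by move=> x; apply: continuous_comp; [exact: oppr_continuous | exact: continuous_expR].
Qed.

Lemma Gamma_integrable (R : realType) (s : R) : 0 < s ->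
  lebesgue_measure.-integrable `]0, +oo[
    (EFin \o (fun t : R => t `^ (s - 1) * expR (- t))).
Proof.
(* Bounding t^(s+1) e^(-t) by B bounds the integrand by B t^(-2), the case [q = 1] of the
   criterion. *)
move=> s0; have [B HB] := powR_expRN_bounded (s - 1 + 2).
apply: (@integrable_powR_dominated _ _ s 1 1 B) => //.
- apply: measurable_funM; first exact: measurable_funTS.
  by apply: measurable_funTS; apply: continuous_measurable_fun; move=> z; exact: continuous_expRN.
- move=> t t0 t1; rewrite ger0_norm ?mulr_ge0 ?powR_ge0 ?expR_ge0// mul1r.
  by rewrite ler_piMr ?powR_ge0// -expR0 ler_expR oppr_le0 ltW.
- move=> t t1; rewrite ger0_norm ?mulr_ge0 ?powR_ge0 ?expR_ge0//.
  have t0 : 0 < t by exact: lt_le_trans t1.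
  have -> : s - 1 = (s - 1 + 2) + (-1 - 1) by ring.
  rewrite powRD; last by rewrite (gt_eqF t0) implybT.
  by rewrite mulrAC ler_pM2r ?powR_gt0// HB.
Qed.

Lemma Gamma_integralD1 (R : realType) (s : R) : 0 < s ->
  Gamma_integral (s + 1) = s * Gamma_integral s.
Proof.
move=> s0; have s10 : 0 < s + 1 by rewrite addr_gt0.
have i1 := Gamma_integrable s0; have i2 := Gamma_integrable s10.
(* This is the derivative of t^s e^(-t), which vanishes at both ends; writing s as [s + 1 - 1]
   matches the integrand of [Gamma_integral (s + 1)]. *)
pose f t : R := s * (t `^ (s - 1) * expR (- t)) - t `^ (s + 1 - 1) * expR (- t).
suff : \int[lebesgue_measure]_(x in `]0, +oo[) f x = 0 - 0.
  rewrite /f RintegralB//=; last by exact: (integrableZl _ s i1).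
  rewrite RintegralZl// subrr => /eqP; rewrite subr_eq0 => /eqP E.
  by rewrite /Gamma_integral -E.
apply: (@Rintegral_ftc0y _ _ (fun t => t `^ s * expR (- t))).
- move=> x x0; apply: cvgB; first apply: cvgM; first exact: cvg_cst.
  + by apply: cvgM; [exact: continuous_powR|exact: continuous_expRN].
  + by apply: cvgM; [exact: continuous_powR|exact: continuous_expRN].
- move=> x x0; have dp := is_derive1_powR s x0.
  have dq : is_derive x 1 (fun t => expR (- t)) (- expR (- x)).
    by apply: is_derive_eq; rewrite /GRing.scale/= mulrN1.
  have := is_deriveM dp dq; rewrite /f /GRing.scale/=.
  suff -> : x `^ s * - expR (- x) + expR (- x) * (s * x `^ (s - 1)) =
    s * (x `^ (s - 1) * expR (- x)) - x `^ (s + 1 - 1) * expR (- x) by [].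
  by rewrite addrK; ring.
- exact: (integrableB _ (integrableZl _ s i1) i2).
- apply: (squeeze_cvgr _ (cvg_cst 0) (powR_cvg0 s0)); near=> x.
  rewrite mulr_ge0 ?powR_ge0 ?expR_ge0//= ler_piMr ?powR_ge0//.
  by rewrite -expR0 ler_expR oppr_le0.
(* At infinity, one extra power of t absorbed by e^(-t) leaves the bound B / t. *)
- have [B HB] := powR_expRN_bounded (s + 1).
  apply: (squeeze_cvgr (f := cst 0) (h := fun x => B * x^-1)).
  + near=> x; rewrite mulr_ge0 ?powR_ge0 ?expR_ge0//=.
    have x1 : 1 <= x by [].
    have x0 : 0 < x by exact: lt_le_trans x1.
    rewrite ler_pdivlMr// (le_trans _ (HB _ x1))//.
    rewrite powRD; last by rewrite (gt_eqF x0) implybT.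
    rewrite powRr1 ?(ltW x0)//.
    by rewrite mulrAC.
  + exact: cvg_cst.
  + rewrite -[0](mulr0 B); apply: cvgM; first exact: cvg_cst.
    apply/(@gtr0_cvgV0 _ _ _ _ (@idfun R)); last exact: cvg_id.
    exact: nbhs_pinfty_gt.
Unshelve. all: by end_near. Qed.

Lemma Gamma_integral1 (R : realType) : Gamma_integral (1 : R) = 1.
Proof.
transitivity (0 - - 1 : R); last by rewrite opprK add0r.
apply: (@Rintegral_ftc0y R (fun t => t `^ (1 - 1) * expR (- t)) (fun t => - expR (- t)) (- 1) 0).
- move=> x x0; apply: cvgM; [exact: continuous_powR|exact: continuous_expRN].
- move=> x x0; rewrite subrr powRr0 mul1r.
  have dq : is_derive x 1 (fun t => expR (- t)) (- expR (- x)).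
    by apply: is_derive_eq; rewrite /GRing.scale/= mulrN1.
  by have := is_deriveN dq; rewrite opprK.
- exact: Gamma_integrable.
- have -> : - 1 = - expR (- 0) :> R by rewrite oppr0 expR0.
  apply: cvgN; apply: cvg_at_right_filter.
  exact: continuous_expRN.
- by rewrite -oppr0; apply: cvgN; exact: cvgr_expR.
Qed.

Lemma Gamma_integral_nat (R : realType) (n : nat) :
  Gamma_integral (n.+1%:R : R) = n`!%:R.
Proof.
elim: n => [|n IHn]; first by rewrite Gamma_integral1.
by rewrite -natr1 Gamma_integralD1 ?ltr0n// IHn factS natrM.
Qed.

Lemma Gamma_integral_ge0 (R : realType) (s : R) : 0 <= Gamma_integral s.
Proof.
by apply: Rintegral_ge0 => x _; rewrite mulr_ge0 ?powR_ge0 ?expR_ge0.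
Qed.

(** Young's inequality for the product of u^th and 1, with conjugate exponents 1/th and 1/(1 -
    th). *)
Lemma powR_le_tangent (R : realType) (u th : R) : 0 <= u -> 0 < th -> th < 1 ->
  u `^ th <= 1 - th + th * u.
Proof.
move=> u0 th0 th1; have th1' : 0 < 1 - th by rewrite subr_gt0.
have := @conjugate_powR R (u `^ th) 1 th^-1 (1 - th)^-1.
rewrite !invrK powR1 mulr1 -powRrM mulfV ?gt_eqF// powRr1// => H.
rewrite addrC mulrC (le_trans (H _ _ _ _ _))// ?powR_ge0 ?invr_gt0//; first by ring.
by rewrite mul1r.
Qed.

(* Wendel's inequality, obtained by integrating the tangent line bound of
   t^th at t = s against the density t^(s-1) e^(-t). *)
Lemma Gamma_integral_wendel (R : realType) (s th : R) : 0 < s -> 0 < th -> th < 1 ->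
  Gamma_integral (s + th) <= s `^ th * Gamma_integral s.
Proof.
move=> s0 th0 th1.
have i1 := Gamma_integrable s0.
have s10 : 0 < s + 1 by rewrite addr_gt0.
have i2 := Gamma_integrable s10.
have i3 : lebesgue_measure.-integrable `]0, +oo[
    (EFin \o (fun t : R => t `^ (s + th - 1) * expR (- t))).
  by apply: Gamma_integrable; rewrite addr_gt0.
(* Since Gamma(s + 1) = s Gamma(s), the constant and linear terms of the tangent line contribute the
   fractions 1 - th and th of the claimed bound. *)
have -> : s `^ th * Gamma_integral s = s `^ th * (1 - th) * Gamma_integral s +
    (s `^ th * th / s) * Gamma_integral (s + 1).
  by rewrite Gamma_integralD1//; field; rewrite gt_eqF.
rewrite -!RintegralZl// -RintegralD//; last 2 first.
- exact: (integrableZl _ _ i1).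
- exact: (integrableZl _ _ i2).
apply: le_Rintegral => //.
  exact: (integrableD _ (integrableZl _ _ i1) (integrableZl _ _ i2)).
move=> t /=; rewrite in_itv/= andbT => t0.
have -> : s + th - 1 = (s - 1) + th by ring.
have -> : s + 1 - 1 = (s - 1) + 1 by ring.
have D v : t `^ (s - 1 + v) = t `^ (s - 1) * t `^ v.
  by rewrite powRD// (gt_eqF t0) implybT.
rewrite !D (powRr1 (ltW t0)).
rewrite [X in _ <= X](_ : _ = (t `^ (s - 1) * expR (- t)) *
  (s `^ th * (1 - th + th * (t / s)))); last first.
  by field; rewrite gt_eqF.
rewrite mulrAC; apply: ler_wpM2l; first by rewrite mulr_ge0 ?powR_ge0 ?expR_ge0.
have ts0 : 0 <= t / s by rewrite divr_ge0 ?ltW.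
apply: le_trans (ler_wpM2l (powR_ge0 s th) (powR_le_tangent ts0 th0 th1)).
by rewrite -powRM ?(ltW s0)// mulrCA mulfV ?gt_eqF// mulr1.
Qed.

(** * The coefficients of the fractional difference *)

Lemma gbinomS (R : realType) (a : R) (k : nat) :
  gbinom a k.+1 = gbinom a k * (a - k%:R) / k.+1%:R.
Proof.
rewrite /gbinom big_ord_recr/= factS natrM; field.
by rewrite nat1r !pnatr_eq0 -!lt0n fact_gt0.
Qed.

Definition gl_weight {R : realType} (a : R) (k : nat) : R := (-1) ^+ k * gbinom a k.

Lemma gl_weight0 (R : realType) (a : R) : gl_weight a 0 = 1.
Proof. by rewrite /gl_weight /gbinom big_ord0 expr0 fact0 invr1 !mulr1. Qed.

Lemma gl_weightS (R : realType) (a : R) (k : nat) :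
  gl_weight a k.+1 = gl_weight a k * (k%:R - a) / k.+1%:R.
Proof. by rewrite /gl_weight gbinomS exprS; field; rewrite nat1r pnatr_eq0. Qed.

(** Induction on the recurrence [gl_weightS]. The identity is the source of the signs of the
    weights, of their absolute summability and of their zero sum. *)
Lemma gl_weightS_psum (R : realType) (a : R) (n : nat) :
  gl_weight a n.+1 = - (a / n.+1%:R) * \sum_(k < n.+1) gl_weight a k.
Proof.
elim: n => [|n IHn].
  by rewrite big_ord1 gl_weightS gl_weight0; field.
rewrite gl_weightS big_ord_recr/= [RHS]mulrDr.
have -> : - (a / n.+2%:R) * (\sum_(i < n.+1) gl_weight a i) =
    (n.+1%:R / n.+2%:R) * gl_weight a n.+1.
  by rewrite IHn; field; rewrite nat1r -(natrD _ 2) !pnatr_eq0.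
by field; rewrite -(natrD _ 2) pnatr_eq0.
Qed.

Section gl_weight_bounds.
Context {R : realType} (a : R).
Hypotheses (a0 : 0 < a) (a1 : a < 1).

Lemma gl_psum_ge0 (n : nat) : 0 <= \sum_(k < n.+1) gl_weight a k.
Proof.
elim: n => [|n IHn]; first by rewrite big_ord1 gl_weight0.
(* Each new partial sum is the previous one times 1 - a/(n + 1), a nonnegative factor. *)
rewrite big_ord_recr/= gl_weightS_psum.
rewrite mulNr -[X in X - _]mul1r -mulrBl mulr_ge0// subr_ge0.
by rewrite ler_pdivrMr ?ltr0n// mul1r (le_trans (ltW a1))// ler1n.
Qed.

Lemma gl_weightS_le0 (n : nat) : gl_weight a n.+1 <= 0.
Proof.
by rewrite gl_weightS_psum mulNr oppr_le0 mulr_ge0 ?gl_psum_ge0// divr_ge0// ltW.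
Qed.

(** After w_0 = 1 no weight is positive, so the absolute values sum to 1 minus a nonnegative partial
    sum. *)
Lemma sum_norm_gl_weight_le1 (n : nat) : \sum_(k < n) `|gl_weight a k.+1| <= 1.
Proof.
have : \sum_(k < n) `|gl_weight a k.+1| = 1 - \sum_(k < n.+1) gl_weight a k.
  rewrite big_ord_recl/= gl_weight0 opprD addrA subrr add0r -sumrN.
  by apply: eq_bigr => k _; rewrite ler0_norm ?gl_weightS_le0.
by move=> ->; rewrite gerBl gl_psum_ge0.
Qed.

(** Wendel's inequality at s = 1 - a, th = a reads 1 = Gamma(1) <= (1 - a)^a Gamma(1 - a), which
    excludes the value 0. *)
Lemma Gamma_integral_gt0 : 0 < Gamma_integral (1 - a).
Proof.
have a1' : 0 < 1 - a by rewrite subr_gt0.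
have := Gamma_integral_wendel a1' a0 a1; rewrite subrK Gamma_integral1 => H.
rewrite lt_neqAle Gamma_integral_ge0 andbT; apply/eqP => E.
by move: H; rewrite -E mulr0 ler10.
Qed.

Lemma Gamma_opp : Gamma (- a) = - (Gamma_integral (1 - a) / a).
Proof.
rewrite /Gamma oppr_gt0 ltNge (ltW a0)/= opprK.
(* As 0 < a < 1, a single step of the extension reaches a positive argument. *)
have -> : Num.truncn a = 0%N by apply: truncn_def; rewrite (ltW a0) a1.
by rewrite big_ord1 addr0 addrC invrN mulrN.
Qed.

(* Meaningful for k >= 1 only: the integral diverges at k = 0. *)
Definition gamma_ratio (k : nat) : R := Gamma_integral (k%:R - a) / k`!%:R.

(** By the functional equation both sides obey the recurrence [gl_weightS], and they agree at index
    1, where w_1 = -a. *)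
Lemma gl_weight_gamma_ratio (k : nat) :
  gl_weight a k.+1 = (Gamma (- a))^-1 * gamma_ratio k.+1.
Proof.
have G0 := Gamma_integral_gt0.
elim: k => [|k IHk].
  rewrite gl_weightS gl_weight0 Gamma_opp /gamma_ratio factS fact0 muln1.
  by field; rewrite gt_eqF//= gt_eqF.
rewrite gl_weightS IHk /gamma_ratio.
have -> : k.+2%:R - a = (k.+1%:R - a) + 1 :> R by rewrite -natr1; ring.
rewrite Gamma_integralD1; last first.
  by rewrite subr_gt0 (lt_le_trans a1)// ler1n.
rewrite [k.+2`!]factS natrM.
have := fact_gt0 k.+1; rewrite -(ltr0n R) => /lt0r_neq0 F0.
field.
rewrite F0 -(natrD _ 2) pnatr_eq0/= Gamma_opp.
by rewrite oppr_eq0 mulf_neq0 ?invr_neq0 ?gt_eqF.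
Qed.

(** With K = k + 1, Wendel at s = K - a, th = a gives Gamma(K) <= (K - a)^a Gamma(K - a); then (K -
    a)^a <= K^a. *)
Lemma gamma_ratio_ge (k : nat) : k.+1%:R `^ (- 1 - a) <= gamma_ratio k.+1.
Proof.
have ka : 0 < k.+1%:R - a by rewrite subr_gt0 (lt_le_trans a1)// ler1n.
have k0 : 0 < k.+1%:R :> R by rewrite ltr0n.
have := Gamma_integral_wendel ka a0 a1; rewrite subrK Gamma_integral_nat => H.
rewrite /gamma_ratio factS natrM ler_pdivlMr ?mulr_gt0 ?ltr0n ?fact_gt0//.
rewrite powRB ?(gt_eqF k0) ?implybT// powR_inv1 ?(ltW k0)//.
rewrite mulrA (mulrAC _ _ k.+1%:R) mulVf ?gt_eqF// mul1r mulrC ler_pdivrMr ?powR_gt0//.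
rewrite (le_trans H)// mulrC ler_wpM2l ?Gamma_integral_ge0//.
by apply: ge0_ler_powR; rewrite ?nnegrE ?(ltW a0) ?(ltW ka) ?(ltW k0)// gerBl ltW.
Qed.

(** With K = k + 1, Wendel at s = K, th = 1 - a bounds Gamma(K + 1 - a) = (K - a) Gamma(K - a). *)
Lemma gamma_ratio_le (k : nat) :
  gamma_ratio k.+1 <= k.+1%:R `^ (- a) / (k.+1%:R - a).
Proof.
have ka : 0 < k.+1%:R - a by rewrite subr_gt0 (lt_le_trans a1)// ler1n.
have k0 : 0 < k.+1%:R :> R by rewrite ltr0n.
have a1' : 0 < 1 - a by rewrite subr_gt0.
have a1'' : 1 - a < 1 by rewrite gtrBl.
have := Gamma_integral_wendel k0 a1' a1''.
rewrite addrA (addrAC _ 1) Gamma_integralD1// Gamma_integral_nat => H.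
rewrite /gamma_ratio ler_pdivrMr ?ltr0n ?fact_gt0// mulrAC ler_pdivlMr//.
rewrite mulrC (le_trans H)// powRB ?(gt_eqF k0) ?implybT// powRr1 ?(ltW k0)//.
by rewrite factS natrM powRN mulrAC mulrC mulrA.
Qed.

(** With K = k + 1, this controls the excess of g_K over the least value of t^(-1-a) on [K, K + 1];
    the right side has order K^(-2-a). *)
Lemma gamma_ratio_gap (k : nat) :
  gamma_ratio k.+1 - (k.+1%:R + 1) `^ (- 1 - a) <=
  (a / (1 - a) + 2) * (k.+1%:R `^ (- 1 - a) / k.+1%:R).
Proof.
have := gamma_ratio_le k.
set K : R := k.+1%:R => H.
have K0 : 0 < K by rewrite ltr0n.
have K1 : 1 <= K by rewrite ler1n.
have a1' : 0 < 1 - a by rewrite subr_gt0.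
have Ka : 0 < K - a by rewrite subr_gt0 (lt_le_trans a1).
set p := K `^ (- 1 - a).
have p0 : 0 < p by rewrite powR_gt0.
have pE : K `^ (- a) = K * p.
  rewrite -[X in X * _]powRr1 ?ltW// /p -powRD ?(gt_eqF K0) ?implybT//.
  by congr (_ `^ _); ring.
(* The constant comes from K/(K - a) - 1 = a/(K - a) <= a/((1 - a) K), valid as K >= 1. *)
have h1 : gamma_ratio k.+1 <= p + p * (a / (1 - a)) / K.
  rewrite (le_trans H)// pE ler_pdivrMr//.
  rewrite (_ : (p + p * (a / (1 - a)) / K) * (K - a) =
    K * p + (K - 1) * (p * a ^+ 2 / ((1 - a) * K))); last first.
    by field; rewrite !gt_eqF.
  rewrite lerDl; apply: mulr_ge0; first by rewrite subr_ge0.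
  by rewrite divr_ge0 ?mulr_ge0 ?exprn_ge0// ltW.
(* As K/(K + 1) < 1, raising the exponent 1 + a to 2 only lowers the power, and (K/(K + 1))^2 >= 1 -
   2/K. *)
have h2 : p * (1 - 2 / K) <= (K + 1) `^ (- 1 - a).
  have K10 : 0 < K + 1 by rewrite addr_gt0.
  have -> : (K + 1) `^ (- 1 - a) = p * (K / (K + 1)) `^ (1 + a).
    rewrite powRM ?invr_ge0 ?ltW// /p mulrA -powRD ?(gt_eqF K0) ?implybT//.
    rewrite (_ : - 1 - a + (1 + a) = 0); last by ring.
    rewrite powRr0 mul1r -powR_inv1 ?ltW// -powRrM; congr (_ `^ _); ring.
  rewrite ler_pM2l//.
  apply: (@le_trans _ _ ((K / (K + 1)) `^ 2%:R)).
    rewrite powR_mulrn; last by rewrite divr_ge0 ?ltW.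
    rewrite -subr_ge0 (_ : _ - _ = (3 * K + 2) / (K * (K + 1) ^+ 2)); last first.
      by field; rewrite !gt_eqF.
    by rewrite divr_ge0 ?addr_ge0 ?mulr_ge0 ?exprn_ge0 ?(ltW K0) ?(ltW K10).
  apply: ger_powR.
    by rewrite divr_gt0//= ler_pdivrMr// mul1r lerDl.
  by rewrite -[2%:R]/(1 + 1) lerD2l ltW.
rewrite (le_trans (lerB h1 h2))// le_eqVlt; apply/orP; left; apply/eqP.
by field; rewrite !gt_eqF.
Qed.

End gl_weight_bounds.

(** * The error estimate for one Hoelder function on the half-line *)

Section one_sided.
Context {R : realType} (a b : R) (F : R -> R) (H M : R).
Hypotheses (a0 : 0 < a) (ab : a < b) (b1 : b <= 1).
Hypotheses (F_cont : continuous F) (F_bounded : forall t, `|F t| <= M)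
  (F_holder : forall s t, `|F s - F t| <= H * `|s - t| `^ b) (H0 : 0 <= H).

Let a1 : a < 1. Proof. exact: lt_le_trans b1. Qed.
Let b0 : 0 < b. Proof. exact: lt_trans ab. Qed.
Let ba0 : 0 < b - a. Proof. by rewrite subr_gt0. Qed.

(** The base point is moved to 0: [F] will be t -> f(x + t) or t -> f(x - t), so one estimate serves
    both directions. *)
Definition marchaud_integrand (t : R) : R := (F t - F 0) / t `^ (1 + a).

Local Notation phi := marchaud_integrand.

Lemma marchaud_integrandE (t : R) : phi t = (F t - F 0) * t `^ (- 1 - a).
Proof. by rewrite /phi -powRN opprD. Qed.

Lemma marchaud_integrand_le (t : R) : 0 < t -> `|phi t| <= H * t `^ (b - a - 1).
Proof.
move=> t0; rewrite marchaud_integrandE normrM [`|t `^ _|]ger0_norm ?powR_ge0//.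
have -> : b - a - 1 = b + (- 1 - a) by ring.
rewrite powRD ?(gt_eqF t0) ?implybT// mulrA ler_wpM2r ?powR_ge0//.
by have := F_holder t 0; rewrite subr0 [`|t|]gtr0_norm.
Qed.

Lemma integrable_marchaud :
  lebesgue_measure.-integrable `]0, +oo[ (EFin \o phi).
Proof.
(* Hoelder continuity gives the exponent b - a - 1 near 0; boundedness of [F] gives -a - 1 at
   infinity. *)
apply: (@integrable_powR_dominated _ _ (b - a) a H (M + M)) => //.
- apply: (eq_measurable_fun (fun t => (F t - F 0) * t `^ (- 1 - a))).
    by move=> t _; rewrite marchaud_integrandE.
  apply: measurable_funM; last exact: measurable_funTS.
  apply: measurable_funTS; apply: measurable_funB => //.
  exact: continuous_measurable_fun.
- by move=> t t0 _; exact: marchaud_integrand_le.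
- move=> t t1; rewrite marchaud_integrandE normrM [`|t `^ _|]ger0_norm ?powR_ge0//.
  have -> : - 1 - a = - a - 1 by ring.
  by rewrite ler_wpM2r ?powR_ge0// (le_trans (ler_normB _ _))// lerD.
Qed.

Lemma integrable_marchaud_itv (x y : R) : 0 <= x ->
  lebesgue_measure.-integrable `]x, y] (EFin \o phi).
Proof.
move=> x0; apply: integrableS integrable_marchaud => // t /=.
by rewrite !in_itv/= andbT => /andP[/(le_lt_trans x0)].
Qed.

(** The first cell has no counterpart in the sum, since the term F(0) - F(0) vanishes; its integral
    is therefore bounded outright. *)
Lemma marchaud_head (h : R) : 0 < h ->
  `|\int[lebesgue_measure]_(t in `]0, h]) phi t| <= H * h `^ (b - a) / (b - a).
Proof.
move=> h0; have i := @integrable_marchaud_itv 0 h (lexx _).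
apply: (le_trans (le_normr_Rintegral _ i)) => //.
have ip := integrable_powR_near0 ba0 h0.
apply: (@le_trans _ _ (\int[lebesgue_measure]_(t in `]0, h]) (H * t `^ (b - a - 1)))).
  apply: (le_Rintegral _ (integrable_abse i) (integrableZl _ H ip)) => //.
  by move=> t /=; rewrite in_itv/= => /andP[t0 _]; exact: marchaud_integrand_le.
rewrite RintegralZl// -mulrA ler_wpM2l//.
rewrite -lee_fin /Rintegral fineK; first exact: integral_powR_near0.
exact: integrable_fin_num.
Qed.

Lemma marchaud_cell_pointwise (h t : R) (k : nat) : 0 < h ->
  k.+1%:R * h < t -> t <= (k.+1%:R + 1) * h ->
  `|phi t - h `^ (- 1 - a) * gamma_ratio a k.+1 * (F (k.+1%:R * h) - F 0)| <=
  H * h `^ b * h `^ (- 1 - a) * (a / (1 - a) + 3) * gamma_ratio a k.+1.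
Proof.
move=> h0 kt tk; set g := gamma_ratio a k.+1; set K : R := k.+1%:R in kt tk *.
have K0 : 0 < K by rewrite ltr0n.
have K1 : 1 <= K by rewrite ler1n.
have Kh0 : 0 < K * h by rewrite mulr_gt0.
have t0 : 0 < t by exact: lt_trans kt.
have ge_g : K `^ (- 1 - a) <= g := gamma_ratio_ge a0 a1 k.
have gap : g - (K + 1) `^ (- 1 - a) <= _ := gamma_ratio_gap a0 a1 k.
set p := h `^ (- 1 - a).
have p0 : 0 < p by rewrite powR_gt0.
have anti x y : 0 < x -> x <= y -> y `^ (- 1 - a) <= x `^ (- 1 - a).
  move=> x0 xy; rewrite -opprD !powRN lef_pV2 ?posrE ?powR_gt0//; last exact: lt_le_trans xy.
  by apply: ge0_ler_powR; rewrite ?nnegrE ?addr_ge0 ?(ltW a0) ?(ltW x0)// (le_trans _ xy)// ltW.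
have t_le : t `^ (- 1 - a) <= p * K `^ (- 1 - a).
  by rewrite mulrC -powRM ?(ltW K0) ?(ltW h0)// anti// ltW.
have t_ge : p * (K + 1) `^ (- 1 - a) <= t `^ (- 1 - a).
  by rewrite mulrC -powRM ?addr_ge0 ?(ltW K0) ?(ltW h0)// anti.
(* The error splits into the variation of [F] over the cell, bounded in [T1], and the discrepancy of
   the kernels, bounded in [T2]. *)
have -> : phi t - p * g * (F (K * h) - F 0) =
    (F t - F (K * h)) * t `^ (- 1 - a) +
    (F (K * h) - F 0) * (t `^ (- 1 - a) - p * g).
  by rewrite marchaud_integrandE; ring.
have Ft : `|F t - F (K * h)| <= H * h `^ b.
  rewrite (le_trans (F_holder _ _))// ler_wpM2l//.
  rewrite ger0_norm ?subr_ge0 ?(ltW kt)//.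
  apply: ge0_ler_powR; rewrite ?nnegrE ?subr_ge0 ?(ltW b0) ?(ltW kt) ?(ltW h0)//.
  by rewrite lerBlDl; move: tk; rewrite mulrDl mul1r.
(* K^b <= K because b <= 1 <= K; this factor K cancels the 1/K of [gap]. *)
have FK : `|F (K * h) - F 0| <= H * h `^ b * K.
  rewrite (le_trans (F_holder _ _))// subr0 gtr0_norm// powRM ?(ltW K0) ?(ltW h0)//.
  rewrite mulrCA mulrC ler_wpM2l ?mulr_ge0 ?powR_ge0//.
  by rewrite -[leRHS]powRr1 ?(ltW K0)// ler_powR.
have Hb0 : 0 <= H * h `^ b by rewrite mulr_ge0 ?powR_ge0.
rewrite (le_trans (ler_normD _ _))// !normrM.
have T1 : `|F t - F (K * h)| * `|t `^ (- 1 - a)| <= H * h `^ b * (p * g).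
  apply: ler_pM => //; rewrite ger0_norm ?powR_ge0//.
  by rewrite (le_trans t_le)// ler_pM2l.
have T2 : `|F (K * h) - F 0| * `|t `^ (- 1 - a) - p * g| <=
    H * h `^ b * K * (p * ((a / (1 - a) + 2) * (K `^ (- 1 - a) / K))).
  apply: ler_pM => //; rewrite ler0_norm; last first.
    by rewrite subr_le0 (le_trans t_le)// ler_pM2l.
  rewrite opprB (@le_trans _ _ (p * (g - (K + 1) `^ (- 1 - a))))//.
    by rewrite mulrBr lerB.
  by rewrite ler_pM2l.
apply: (le_trans (lerD T1 T2)).
rewrite (_ : H * h `^ b * K * _ =
  H * h `^ b * p * (a / (1 - a) + 2) * K `^ (- 1 - a)); last first.
  by field; rewrite !gt_eqF ?subr_gt0.
rewrite (_ : H * h `^ b * p * _ * g =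
  H * h `^ b * (p * g) + H * h `^ b * p * (a / (1 - a) + 2) * g); last by ring.
rewrite lerD2l ler_wpM2l//; apply: mulr_ge0; first by rewrite mulr_ge0 ?(ltW p0).
by rewrite addr_ge0// divr_ge0 ?subr_ge0 ?(ltW a0) ?(ltW a1).
Qed.

Lemma powR_cell (h : R) : 0 < h -> h `^ (- 1 - a) * h = h `^ (- a).
Proof.
move=> h0; rewrite -[X in _ * X]powRr1 ?(ltW h0)// -powRD ?(gt_eqF h0) ?implybT//.
by congr (_ `^ _); ring.
Qed.

Lemma marchaud_cell (h : R) (k : nat) : 0 < h ->
  `|\int[lebesgue_measure]_(t in `]k.+1%:R * h, k.+2%:R * h]) phi t -
    h `^ (- a) * gamma_ratio a k.+1 * (F (k.+1%:R * h) - F 0)| <=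
  H * h `^ (b - a) * (a / (1 - a) + 3) * gamma_ratio a k.+1.
Proof.
move=> h0; have kh : k.+1%:R * h <= k.+2%:R * h by rewrite ler_wpM2r ?(ltW h0)// ler_nat.
have kh0 : 0 <= k.+1%:R * h by rewrite mulr_ge0// ltW.
have hh : k.+2%:R * h - k.+1%:R * h = h by rewrite -[k.+2%:R]natr1; ring.
have hba : h `^ (b - a) = h `^ b * (h `^ (- 1 - a) * h).
  by rewrite powR_cell// powRD ?(gt_eqF h0) ?implybT.
have := Rintegral_cst_approx
  (c := h `^ (- 1 - a) * gamma_ratio a k.+1 * (F (k.+1%:R * h) - F 0))
  (e := H * h `^ b * h `^ (- 1 - a) * (a / (1 - a) + 3) * gamma_ratio a k.+1)
  kh (integrable_marchaud_itv _ kh0).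
rewrite hh hba -(powR_cell h0).
have -> : h `^ (- 1 - a) * gamma_ratio a k.+1 * (F (k.+1%:R * h) - F 0) * h =
  h `^ (- 1 - a) * h * gamma_ratio a k.+1 * (F (k.+1%:R * h) - F 0) by ring.
have -> : H * h `^ b * h `^ (- 1 - a) * (a / (1 - a) + 3) * gamma_ratio a k.+1 * h =
  H * (h `^ b * (h `^ (- 1 - a) * h)) * (a / (1 - a) + 3) * gamma_ratio a k.+1 by ring.
apply=> t kt tk; apply: marchaud_cell_pointwise => //.
by rewrite natr1.
Qed.

Local Notation c := (Gamma (- a))^-1.

Lemma norm_gl_weight (k : nat) : `|gl_weight a k.+1| = `|c| * gamma_ratio a k.+1.
Proof.
rewrite gl_weight_gamma_ratio// normrM; congr (_ * _); rewrite ger0_norm//.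
by rewrite (le_trans _ (gamma_ratio_ge a0 a1 k))// powR_ge0.
Qed.

(** The first summand comes from [marchaud_head], the second from the cells, weighted by absolute
    weights of total at most 1. *)
Definition marchaud_GL_cst : R := `|c| / (b - a) + (a / (1 - a) + 3).

Lemma marchaud_GL_cst_gt0 : 0 < marchaud_GL_cst.
Proof.
rewrite /marchaud_GL_cst ltr_wpDl ?divr_ge0 ?(ltW ba0)//.
by rewrite ltr_wpDl// divr_ge0 ?subr_ge0 ?(ltW a0) ?(ltW a1).
Qed.

(** Induction on the number of cells: [n = 0] is the head, and each step adds one cell, whose error
    times |c| carries the factor |w_{n+1}|. *)
Lemma marchaud_partial_sum (h : R) (n : nat) : 0 < h ->
  `|c * \int[lebesgue_measure]_(t in `]0, n.+1%:R * h]) phi t -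
    h `^ (- a) * \sum_(k < n) gl_weight a k.+1 * (F (k.+1%:R * h) - F 0)| <=
  H * h `^ (b - a) * (`|c| / (b - a) +
    (a / (1 - a) + 3) * \sum_(k < n) `|gl_weight a k.+1|).
Proof.
move=> h0; elim: n => [|n IHn].
  rewrite !big_ord0 !mulr0 subr0 addr0 mul1r normrM.
  rewrite (_ : H * h `^ (b - a) * _ = `|c| * (H * h `^ (b - a) / (b - a))); last by ring.
  by rewrite ler_wpM2l// marchaud_head.
have n0 : 0 <= n.+1%:R * h by rewrite mulr_ge0// ltW.
have nn : n.+1%:R * h <= n.+2%:R * h by rewrite ler_wpM2r ?(ltW h0)// ler_nat.
have i := integrable_marchaud_itv (n.+2%:R * h) (lexx 0).
have E : \int[lebesgue_measure]_(t in `]0, n.+2%:R * h]) phi t =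
    \int[lebesgue_measure]_(t in `]0, n.+1%:R * h]) phi t +
    \int[lebesgue_measure]_(t in `]n.+1%:R * h, n.+2%:R * h]) phi t.
  by rewrite -(Rintegral_itvB (x := n.+1%:R * h) i) ?bnd_simp// addrC subrK.
rewrite E !big_ord_recr/= norm_gl_weight gl_weight_gamma_ratio//.
move: IHn (marchaud_cell n h0).
move: (gamma_ratio a n.+1) (F (n.+1%:R * h) - F 0) => g D.
move: (\int[_]_(_ in _) _) (\int[_]_(_ in _) _) => I1 I2.
move: (\sum_(i < n) _) (\sum_(i < n) _) => S S' IH /(ler_wpM2l (normr_ge0 c)).
rewrite -normrM => /(lerD IH)/(le_trans (ler_normD _ _)) => H1.
apply: le_trans (_ : _ <= _) (le_trans H1 _).
  by rewrite le_eqVlt; apply/orP; left; apply/eqP; congr `|_|; ring.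
by rewrite le_eqVlt; apply/orP; left; apply/eqP; ring.
Qed.

(** By [gl_weightS_psum] the partial sum equals (n + 1)/a times |w_{n+1}|, which [gamma_ratio_le]
    bounds by a multiple of (n + 1)^(-a). *)
Lemma gl_psum_cvg0 : \sum_(k < n.+1) gl_weight a k @[n --> \oo] --> 0.
Proof.
have Ginv : 0 < 1 - a by rewrite subr_gt0.
apply: (squeeze_cvgr (f := cst 0)
  (h := fun n => `|c| / (a * (1 - a)) * n.+1%:R^-1 `^ a)).
- near=> n; rewrite gl_psum_ge0//=.
  have n1 : 0 < n.+1%:R :> R by rewrite ltr0n.
  have na : 0 < n.+1%:R - a by rewrite subr_gt0 (lt_le_trans a1)// ler1n.
  have -> : \sum_(k < n.+1) gl_weight a k = n.+1%:R / a * `|gl_weight a n.+1|.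
    rewrite ler0_norm ?gl_weightS_le0// gl_weightS_psum.
    by field; rewrite nat1r pnatr_eq0/= gt_eqF.
  rewrite norm_gl_weight (_ : _ * (_ * _) = `|c| / a * (n.+1%:R * gamma_ratio a n.+1)); last by ring.
  rewrite (_ : `|c| / (a * (1 - a)) * _ =
    `|c| / a * (n.+1%:R^-1 `^ a / (1 - a))); last by rewrite invfM; ring.
  rewrite ler_wpM2l ?divr_ge0 ?(ltW a0)//.
  rewrite (le_trans (ler_wpM2l (ltW n1) (gamma_ratio_le a0 a1 n)))//.
  have -> : n.+1%:R^-1 `^ a = n.+1%:R `^ (- a) :> R.
    by rewrite -(powR_inv1 (ltW n1)) -powRrM mulN1r.
  rewrite mulrCA ler_wpM2l ?powR_ge0//.
  rewrite ler_pdivrMr// ler_pdivlMl// mulrBl mul1r lerD2l lerN2.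
  by rewrite ler_peMr ?(ltW a0)// ler1n.
- exact: cvg_cst.
- rewrite -[0](mulr0 (`|c| / (a * (1 - a)))); apply: cvgM; first exact: cvg_cst.
  have := (@cvg_comp _ _ _ (fun n => n.+1%:R^-1) (fun x : R => x `^ a) _ _ _ _ (powR_cvg0 a0)).
  apply; exact: cvg_harmonic_at_right.
Unshelve. all: by end_near. Qed.

Definition GL_term (h : R) : R^nat := fun k => gl_weight a k * F (k%:R * h).

Lemma cvg_GL_series (h : R) : cvgn (series (GL_term h)).
Proof.
apply: normed_cvg.
have M0 : 0 <= M by exact: le_trans (normr_ge0 _) (F_bounded 0).
apply: (@series_le_cvg _ _ (fun k => M * `|gl_weight a k|)) => [n|n|n|].
- exact: normr_ge0.
- by rewrite mulr_ge0.
- by rewrite /= /GL_term normrM mulrC ler_wpM2r.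
- apply: nondecreasing_is_cvgn.
    by apply: nondecreasing_series => n _ _; rewrite mulr_ge0.
  (* One unit accounts for w_0, the other for all later weights. *)
  exists (M * (1 + 1)) => _ [n _ <-]; rewrite /series/= -mulr_sumr ler_wpM2l//.
  case: n => [|n]; first by rewrite big_geq.
  rewrite big_mkord big_ord_recl/= gl_weight0 normr1 lerD2l.
  exact: sum_norm_gl_weight_le1.
Qed.

(** The multiple of F(0) is isolated because it tends to 0 with the partial sums of the weights. *)
Lemma series_GL_term (h : R) (n : nat) :
  series (GL_term h) n.+1 = F 0 * (\sum_(k < n.+1) gl_weight a k) +
    \sum_(k < n) gl_weight a k.+1 * (F (k.+1%:R * h) - F 0).
Proof.
rewrite /series/= big_mkord !big_ord_recl/= {1}/GL_term gl_weight0 mul0r mul1r.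
rewrite mulrDr mulr1 -addrA; congr (_ + _).
rewrite mulr_sumr -big_split/=; apply: eq_bigr => k _.
by rewrite /GL_term/=; ring.
Qed.

Lemma marchaud_GL_error (h : R) : 0 < h ->
  `|c * \int[lebesgue_measure]_(t in `]0, +oo[) phi t -
    limn (series (GL_term h)) / h `^ a| <= marchaud_GL_cst * H * h `^ (b - a).
Proof.
move=> h0.
pose I n := \int[lebesgue_measure]_(t in `]0, n.+1%:R * h]) phi t.
pose S n := \sum_(k < n) gl_weight a k.+1 * (F (k.+1%:R * h) - F 0).
have cI : I n @[n --> \oo] --> \int[lebesgue_measure]_(t in `]0, +oo[) phi t.
  apply: Rintegral_cvg_exhaustion => //.
  - by move=> n t /=; rewrite !in_itv/= andbT => /andP[].
  - move=> t /=; rewrite in_itv/= andbT => t0; near=> n.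
    rewrite in_itv/= t0/= -ler_pdivrMr// (@le_trans _ _ n%:R)//; last by rewrite ler_nat.
    by near: n; exact: nbhs_infty_ger.
  - exact: integrable_marchaud.
have cS : S n @[n --> \oo] --> limn (series (GL_term h)).
  have -> : S = (fun n => series (GL_term h) n.+1 - F 0 * (\sum_(k < n.+1) gl_weight a k)).
    by apply/funext => n; rewrite series_GL_term addrC addKr.
  rewrite -[limn _]subr0 -[X in _ - X](mulr0 (F 0)); apply: cvgB.
    by rewrite cvg_shiftS; exact: cvg_GL_series.
  by apply: cvgM; [exact: cvg_cst|exact: gl_psum_cvg0].
have cu : `|c * I n - h `^ (- a) * S n| @[n --> \oo] -->
    `|c * \int[lebesgue_measure]_(t in `]0, +oo[) phi t -
     h `^ (- a) * limn (series (GL_term h))|.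
  by apply: cvg_norm; apply: cvgB; apply: cvgM => //; exact: cvg_cst.
rewrite [_ / _]mulrC -powRN -(cvg_lim _ cu)//; apply: limr_le.
  by apply/cvg_ex; eexists; exact: cu.
(* The absolute weights sum to at most 1, so the bound is uniform in n and survives the limit. *)
near=> n; rewrite (le_trans (marchaud_partial_sum n h0))//.
rewrite (_ : marchaud_GL_cst * H * _ = H * h `^ (b - a) * marchaud_GL_cst); last by ring.
rewrite ler_wpM2l ?mulr_ge0 ?powR_ge0// lerD2l ler_piMr ?sum_norm_gl_weight_le1//.
by rewrite addr_ge0// divr_ge0 ?subr_ge0 ?(ltW a0) ?(ltW a1).
Unshelve. all: by end_near. Qed.

End one_sided.

(** * Bounds extracted from the space C^{0,beta} *)

Lemma holder_seminorm_ge0 (R : realType) (b : R) (f : R -> R) :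
  (0 <= holder_seminorm b f)%E.
Proof.
apply: (@le_trans _ _ (`|f 0 - f 1| / `|0 - 1| `^ b)%:E).
  by rewrite lee_fin divr_ge0 ?powR_ge0.
apply: ereal_sup_ubound; exists (0, 1) => //=.
by rewrite eq_sym oner_eq0.
Qed.

Lemma holder_seminorm_le (R : realType) (b H : R) (f : R -> R) : b != 0 ->
  holder_seminorm b f = H%:E -> forall s t, `|f s - f t| <= H * `|s - t| `^ b.
Proof.
(* The supremum ranges over distinct points; on the diagonal both sides vanish, as 0^b = 0 for b
   nonzero. *)
move=> b0 fH s t; have [->|st] := eqVneq s t.
  by rewrite !subrr normr0 powR0// mulr0.
have st0 : 0 < `|s - t| by rewrite normr_gt0 subr_eq0.
rewrite -ler_pdivrMr ?powR_gt0// -lee_fin -fH.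
by apply: ereal_sup_ubound; exists (s, t).
Qed.

(** The infinity norm unfolds to an essential supremum under the condition that the whole space has
    positive measure. *)
Lemma lebesgue_measure_setT_gt0 (R : realType) :
  (0 < lebesgue_measure [set: R])%E.
Proof.
apply: (@lt_le_trans _ _ (lebesgue_measure (`[0, 1]%classic : set R))).
  by rewrite /= lebesgue_measure_itv/= lte_fin ltr01 sube0 lte_fin.
by apply: le_measure; rewrite ?inE.
Qed.

(* A point where |f| exceeds its essential supremum by more than the Holder
   constant would have a unit ball of such excess, of positive measure. *)
Lemma holder_ess_bounded (R : realType) (b H r : R) (f : R -> R) : 0 < b -> 0 <= H ->
  (forall s t, `|f s - f t| <= H * `|s - t| `^ b) ->
  ('N[lebesgue_measure]_+oo [EFin \o f] <= r%:E)%E ->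
  forall t, `|f t| <= r + H.
Proof.
move=> b0 H0 fH; rewrite unlock lebesgue_measure_setT_gt0 => /ess_supP fr y.
rewrite leNgt; apply/negP => ry.
have : lebesgue_measure.-negligible (`[y, y + 1]%classic : set R).
  apply: negligibleS fr => t /=; rewrite in_itv/= => /andP[yt ty].
  apply/negP; rewrite -ltNge lte_fin -(ltrD2r H) (lt_le_trans ry)//.
  rewrite -lerBlDl (le_trans (lerB_dist _ _))// (le_trans (fH _ _))//.
  rewrite ler_piMr//; apply: (@le_trans _ _ (1 `^ b)); last by rewrite powR1.
  apply: ge0_ler_powR; rewrite ?nnegrE ?(ltW b0)//.
  by rewrite distrC ger0_norm ?subr_ge0// lerBlDl.
move=> /negligibleP => /(_ (measurable_itv _)).
rewrite /= lebesgue_measure_itv/= lte_fin ltrDl ltr01 -EFinD => -[].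
by rewrite addrC addKr => /eqP; rewrite oner_eq0.
Qed.

Lemma C0beta_bounds (R : realType) (b : R) (f : R -> R) : 0 < b -> C0beta b f ->
  exists H M : R, [/\ 0 <= H, holder_seminorm b f = H%:E,
    forall s t, `|f s - f t| <= H * `|s - t| `^ b & forall t, `|f t| <= M].
Proof.
move=> b0 [_]; have := holder_seminorm_ge0 b f.
have := @Lnorm_ge0 _ _ _ (@lebesgue_measure R) +oo%E (EFin \o f).
(* Both summands are nonnegative, so finiteness of the sum makes each of them real. *)
case E : Lnorm => [r| |]//; case E' : holder_seminorm => [H| |]// r0 H0 _.
have H0' : 0 <= H by rewrite -lee_fin.
have fH := holder_seminorm_le (lt0r_neq0 b0) E'.
exists H, (r + H); split => //.
by apply: holder_ess_bounded fH _ => //; rewrite E.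
Qed.

(** * Convergence of the difference quotients in both directions *)

Lemma cvg_at_right0_powR_bound (R : realType) (p K D : R) (u : R -> R) : 0 < p ->
  (forall h, 0 < h -> `|D - u h| <= K * h `^ p) ->
  u h @[h --> 0^'+] --> D.
Proof.
move=> p0 uD; have Kp : K * h `^ p @[h --> 0^'+] --> 0.
  by rewrite -[0 in X in _ --> X](mulr0 K); apply: cvgM; [exact: cvg_cst|exact: powR_cvg0].
apply: (squeeze_cvgr (f := fun h => D - K * h `^ p) (h := fun h => D + K * h `^ p)).
- near=> h; have h0 : 0 < h by [].
  by have := uD _ h0; rewrite distrC ler_distl.
- by rewrite -[D in X in _ --> X]subr0; apply: cvgB => //; exact: cvg_cst.
- by rewrite -[D in X in _ --> X]addr0; apply: cvgD => //; exact: cvg_cst.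
Unshelve. all: by end_near. Qed.

(** Composition with an isometry [T] preserves the Hoelder bound, so the seminorm of [f] itself
    appears; [T] will be t -> x + t or t -> x - t. *)
Lemma marchaud_GL_isometry (R : realType) (a b : R) (f T : R -> R) :
  0 < a -> a < b -> b <= 1 -> C0beta b f ->
  continuous T -> (forall s t, `|T s - T t| = `|s - t|) ->
  let I := (Gamma (- a))^-1 *
    \int[lebesgue_measure]_(t in `]0, +oo[) marchaud_integrand a (f \o T) t in
  let D h := limn (series (GL_term a (f \o T) h)) / h `^ a in
  [/\ lebesgue_measure.-integrable `]0, +oo[
        (EFin \o marchaud_integrand a (f \o T)),
      forall h, cvgn (series (GL_term a (f \o T) h)),
      D h @[h --> 0^'+] --> I &
      forall h, 0 < h -> (`|I - D h|%:E <=
        (marchaud_GL_cst a b)%:E * holder_seminorm b f * (h `^ (b - a))%:E)%E].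
Proof.
move=> a0 ab b1 fC cT isoT I D; have b0 : 0 < b by exact: lt_trans ab.
have [H [M [H0 fH holder bounded]]] := C0beta_bounds b0 fC.
have F_cont : continuous (f \o T).
  by move=> t; apply: continuous_comp; [exact: cT|exact: fC.1].
have F_holder s t : `|(f \o T) s - (f \o T) t| <= H * `|s - t| `^ b.
  by rewrite -(isoT s t); exact: holder.
have F_bounded t : `|(f \o T) t| <= M by exact: bounded.
have err h : 0 < h -> `|I - D h| <= marchaud_GL_cst a b * H * h `^ (b - a).
  exact: (marchaud_GL_error a0 ab b1 F_cont F_bounded F_holder H0).
split.
- exact: integrable_marchaud F_holder.
- by move=> h; apply: (cvg_GL_series a0 ab b1 F_bounded).
- by apply: cvg_at_right0_powR_bound err; rewrite subr_gt0.
- by move=> h h0; rewrite fH -!EFinM lee_fin err.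
Qed.

Theorem theorem4 (R : realType) (alpha beta : R)
    (alpha_gt0 : 0 < alpha) (alpha_lt_beta : alpha < beta)
    (beta_le1 : beta <= 1) :
  (forall f : R -> R, C0beta beta f -> forall x : R,
     [/\ lebesgue_measure.-integrable `]0, +oo[
           (EFin \o marchaud_right_integrand alpha f x),
         (forall h : R, 0 < h -> cvgn (series (fdiff_plus_term alpha h f x))),
         cvg (fdiff_plus alpha h f x / h `^ alpha @[h --> 0^'+])
       & GL_plus alpha f x = marchaud_right alpha f x] /\
     [/\ lebesgue_measure.-integrable `]0, +oo[
           (EFin \o marchaud_left_integrand alpha f x),
         (forall h : R, 0 < h -> cvgn (series (fdiff_minus_term alpha h f x))),
         cvg (fdiff_minus alpha h f x / h `^ alpha @[h --> 0^'+])
       & GL_minus alpha f x = marchaud_left alpha f x]) /\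
  (exists2 C : R, 0 < C &
     forall f : R -> R, C0beta beta f -> forall x h : R, 0 < h ->
       (`|marchaud_right alpha f x - fdiff_plus alpha h f x / h `^ alpha|%:E
          <= C%:E * holder_seminorm beta f * (h `^ (beta - alpha))%:E)%E /\
       (`|marchaud_left alpha f x - fdiff_minus alpha h f x / h `^ alpha|%:E
          <= C%:E * holder_seminorm beta f * (h `^ (beta - alpha))%:E)%E).
Proof.
have right f x (fC : C0beta beta f) := @marchaud_GL_isometry
  R alpha beta f (fun t => x + t) alpha_gt0 alpha_lt_beta beta_le1 fC.
have left f x (fC : C0beta beta f) := @marchaud_GL_isometry
  R alpha beta f (fun t => x - t) alpha_gt0 alpha_lt_beta beta_le1 fC.
have rE f x : marchaud_integrand alpha (f \o (fun t => x + t)) =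
    marchaud_right_integrand alpha f x.
  by apply/funext => t; rewrite /marchaud_integrand/= addr0.
have lE f x : marchaud_integrand alpha (f \o (fun t => x - t)) =
    marchaud_left_integrand alpha f x.
  by apply/funext => t; rewrite /marchaud_integrand/= subr0.
have right_cont (x : R) : continuous (fun t => x + t).
  by move=> t; apply: cvgD; [exact: cvg_cst|exact: cvg_id].
have left_cont (x : R) : continuous (fun t => x - t).
  by move=> t; apply: cvgB; [exact: cvg_cst|exact: cvg_id].
have right_iso (x s t : R) : `|(x + s) - (x + t)| = `|s - t|.
  by congr `|_|; ring.
have left_iso (x s t : R) : `|(x - s) - (x - t)| = `|s - t|.
  by rewrite [RHS]distrC; congr `|_|; ring.
split.
  move=> f fC x; split.
  (* The series for the composed function is convertible to that of [fdiff_plus]; the integrand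
     contains x + 0 and is rewritten by [rE]. *)
  - have [] := right f x fC (right_cont x) (right_iso x).
    rewrite rE => i s c _; split => //; first by move=> h _; exact: s.
      by apply/cvg_ex; eexists; exact: c.
    exact: (cvg_lim _ c).
  - have [] := left f x fC (left_cont x) (left_iso x).
    rewrite lE => i s c _; split => //; first by move=> h _; exact: s.
      by apply/cvg_ex; eexists; exact: c.
    exact: (cvg_lim _ c).
(* The witness is built from the two exponents alone, hence is uniform in f, x and h. *)
exists (marchaud_GL_cst alpha beta); first exact: marchaud_GL_cst_gt0.
move=> f fC x h h0; split.
- have [_ _ _] := right f x fC (right_cont x) (right_iso x).
  by rewrite rE => /(_ _ h0).
- have [_ _ _] := left f x fC (left_cont x) (left_iso x).
  by rewrite lE => /(_ _ h0).
Qed.
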